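(* Let $n,m\ge1$, $\tilde m=\lfloor m/2\rfloor+1$, $\beta_*\in\mathbb{R}^p$. Consider $m$ mini-batches $(X^{(i)},y^{(i)})$ with $X^{(i)}\in\mathbb{R}^{p\times n}$ and $y^{(i)}=[X^{(i)}]^T\beta_*+u^{(i)}+\varepsilon^{(i)}$, $u^{(i)}\in\mathbb{R}^n$ an arbitrary corruption vector. Let $\mathcal{A}$ be a per-batch estimator (the algorithm HRR) and $\gamma_0\in(0,1)$, $\epsilon>0$ be such that on every mini-batch with $\|u^{(i)}\|_0\le\gamma_0 n$ the estimate $\beta^{(i)}=\mathcal{A}(X^{(i)},y^{(i)})$ satisfies $\|\beta^{(i)}-\beta_*\|_2\le\epsilon$. Suppose the total corruption ratio is at most $\gamma_0/2$, i.e. $\sum_{i=1}^m\|u^{(i)}\|_0\le\frac{\gamma_0}{2}mn$. Run the DRLR algorithm: compute $\beta^{(i)}=\mathcal{A}(X^{(i)},y^{(i)})$ for $i=1,\dots,m$; choose a pivot batch $p\in\arg\min_i\sigma_{\tilde m}(d^{(i)})$; form the dominating set $\Psi=\{\delta_k(d^{(p)}):1\le k\le\tilde m\}$; and output any $\hat\beta\in\arg\min_{\beta\in\mathbb{R}^p}\sum_{i\in\Psi}\|\beta^{(i)}-\beta\|_2$. Then $\|\hat\beta-\beta_*\|_2\le5\epsilon$.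
   Context: For each $i$, $d^{(i)}\in\mathbb{R}^m$ is the distance vector with $d^{(i)}_j=\|\beta^{(i)}-\beta^{(j)}\|_2$ (including $d^{(i)}_i=0$); $\sigma_k(d^{(i)})$ is the $k$-th smallest entry of $d^{(i)}$ and $\delta_k(d^{(i)})$ is the index $j$ of that $k$-th smallest entry (ties broken arbitrarily, so that $\Psi$ consists of $\tilde m$ distinct indices). $\|\cdot\|_0$ counts nonzero entries. *)

(* Defs.v *)
From mathcomp Require Import all_boot all_order all_algebra.
From mathcomp Require Import reals.

Set Implicit Arguments.
Unset Strict Implicit.
Unset Printing Implicit Defensive.

Import Order.TTheory GRing.Theory Num.Theory.

Local Open Scope ring_scope.

(* The norm MathComp-Analysis puts on matrices is the max norm, hence this one. *)
Definition l2norm (R : realType) (p : nat) (x : 'cV[R]_p) : R :=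
  Num.sqrt (\sum_(i < p) x i 0 ^+ 2).

Definition l0norm (R : realType) (n : nat) (u : 'cV[R]_n) : nat :=
  #|[set j : 'I_n | u j 0 != 0]|.

Definition mtilde (m : nat) : nat := (m %/ 2).+1.

Definition dist_vec (R : realType) (p m : nat) (beta : 'I_m -> 'cV[R]_p)
    (i : 'I_m) : 'cV[R]_m :=
  \col_(j < m) l2norm (beta i - beta j).

(* The rank k is counted from 1; values outside 1 <= k <= m are never used. *)
Definition sigma (R : realType) (m : nat) (k : nat) (d : 'cV[R]_m) : R :=
  nth 0 (sort <=%R [seq d j 0 | j : 'I_m]) k.-1.

(* delta k is the index of the k-th smallest entry of d (1 <= k <= m). This is
   a relation, not a function of d, because ties may be broken in any way;
   different ranks still have to get different indices. *)
Definition is_delta (R : realType) (m : nat) (d : 'cV[R]_m)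
    (delta : nat -> 'I_m) : Prop :=
  (forall k : nat, (1 <= k <= m)%N -> d (delta k) 0 = sigma k d) /\
  (forall k l : nat, (1 <= k <= m)%N -> (1 <= l <= m)%N ->
     delta k = delta l -> k = l).

Definition is_pivot (R : realType) (p m : nat) (beta : 'I_m -> 'cV[R]_p)
    (q : 'I_m) : Prop :=
  forall i : 'I_m,
    sigma (mtilde m) (dist_vec beta q) <= sigma (mtilde m) (dist_vec beta i).

Definition dominating_set (m : nat) (delta : nat -> 'I_m) : {set 'I_m} :=
  [set delta k.+1 | k : 'I_(mtilde m)].

Definition is_geometric_median (R : realType) (p m : nat)
    (beta : 'I_m -> 'cV[R]_p) (Psi : {set 'I_m}) (b : 'cV[R]_p) : Prop :=
  forall b' : 'cV[R]_p,
    \sum_(i in Psi) l2norm (beta i - b) <= \sum_(i in Psi) l2norm (beta i - b').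

(* betahat is a possible output of the DRLR algorithm run with the per-batch
   estimator A, for some choice of the pivot, of the tie-breaking and of the
   minimizer. *)
Definition DRLR_output (R : realType) (p n m : nat)
    (A : 'M[R]_(p, n) -> 'cV[R]_n -> 'cV[R]_p)
    (X : 'I_m -> 'M[R]_(p, n)) (y : 'I_m -> 'cV[R]_n)
    (betahat : 'cV[R]_p) : Prop :=
  let beta := fun i : 'I_m => A (X i) (y i) in
  exists (q : 'I_m) (delta : nat -> 'I_m),
    [/\ is_pivot beta q,
        is_delta (dist_vec beta q) delta &
        is_geometric_median beta (dominating_set delta) betahat].

(* Main.v *)
(** Fewer than half of the batches are too corrupted, so at least [mtilde m] of
    them are good, and any good batch has [mtilde m] distances at most
    [2 * epsilon].  Hence the dominating set lies in the ball of radius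
    [2 * epsilon] around the pivot estimate.  It meets the good batches, being
    a majority as they are, so the pivot estimate is within [3 * epsilon] of
    [betastar].  A geometric median of points of a ball stays in that ball,
    since projecting onto the ball brings an outer point strictly closer to
    all of them; this gives [2 * epsilon + 3 * epsilon]. *)
Require Import Defs.
From mathcomp Require Import all_boot all_order all_algebra.
From mathcomp Require Import reals.
From mathcomp Require Import zify ring lra.

Set Implicit Arguments.
Unset Strict Implicit.
Unset Printing Implicit Defensive.

Import Order.TTheory GRing.Theory Num.Theory.

Local Open Scope ring_scope.

Definition dot (R : realType) (p : nat) (x y : 'cV[R]_p) : R :=
  \sum_(i < p) x i 0 * y i 0.

Lemma l2norm_ge0 (R : realType) (p : nat) (x : 'cV[R]_p) : 0 <= l2norm x.
Proof. exact: sqrtr_ge0. Qed.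

Lemma sqr_l2norm (R : realType) (p : nat) (x : 'cV[R]_p) :
  l2norm x ^+ 2 = dot x x.
Proof.
rewrite sqr_sqrtr; last by apply: sumr_ge0 => i _; exact: sqr_ge0.
by apply: eq_bigr => i _; rewrite expr2.
Qed.

Lemma l2norm_eq0 (R : realType) (p : nat) (x : 'cV[R]_p) :
  l2norm x = 0 -> x = 0.
Proof.
move=> x0; have /eqP : dot x x = 0 by rewrite -sqr_l2norm x0 expr0n.
rewrite psumr_eq0 => [/allP xx0|i _]; last by rewrite -expr2 sqr_ge0.
apply/colP => i; rewrite mxE.
by have := xx0 i (mem_index_enum i); rewrite -expr2 sqrf_eq0 => /eqP.
Qed.

Lemma sqr_l2norm_lincomb (R : realType) (p : nat) (a b : R) (x y : 'cV[R]_p) :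
  l2norm (a *: x - b *: y) ^+ 2
  = a ^+ 2 * l2norm x ^+ 2 - 2 * (a * b) * dot x y + b ^+ 2 * l2norm y ^+ 2.
Proof.
rewrite !sqr_l2norm /dot !mulr_sumr -sumrB -big_split /=.
by apply: eq_bigr => i _; rewrite !mxE; ring.
Qed.

(** Cauchy-Schwarz. For nonzero vectors, expanding the square of the norm of
    [l2norm y *: x - l2norm x *: y] gives [2 * (l2norm x * l2norm y)] times the gap between the two
    sides. Vectors of norm zero are treated apart, as this factor must be cancelled. *)
Lemma dot_le_l2norm (R : realType) (p : nat) (x y : 'cV[R]_p) :
  dot x y <= l2norm x * l2norm y.
Proof.
have [x0|x_neq0] := eqVneq (l2norm x) 0.
  rewrite x0 mul0r (l2norm_eq0 x0) /dot big1 // => i _.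
  by rewrite mxE mul0r.
have [y0|y_neq0] := eqVneq (l2norm y) 0.
  rewrite y0 mulr0 (l2norm_eq0 y0) /dot big1 // => i _.
  by rewrite mxE mulr0.
have xy_gt0 : 0 < l2norm x * l2norm y.
  by rewrite mulr_gt0 // lt_neqAle eq_sym l2norm_ge0 andbT.
have := sqr_ge0 (l2norm (l2norm y *: x - l2norm x *: y)).
rewrite sqr_l2norm_lincomb => H.
rewrite -(ler_pM2l xy_gt0); lra.
Qed.

Lemma l2norm_triangle (R : realType) (p : nat) (x y z : 'cV[R]_p) :
  l2norm (x - z) <= l2norm (x - y) + l2norm (y - z).
Proof.
rewrite -(ler_pXn2r (ltn0Sn 1)) ?nnegrE ?addr_ge0 ?l2norm_ge0 //.
have -> : x - z = 1 *: (x - y) - (-1) *: (y - z).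
  by rewrite scaleNr opprK !scale1r addrA subrK.
rewrite sqr_l2norm_lincomb.
have := dot_le_l2norm (x - y) (y - z); lra.
Qed.

Lemma l2norm_distC (R : realType) (p : nat) (x y : 'cV[R]_p) :
  l2norm (x - y) = l2norm (y - x).
Proof.
by congr Num.sqrt; apply: eq_bigr => i _; rewrite !mxE; ring.
Qed.

(** The comparison point is the projection of [b] onto the ball. With [t = l2norm (b - c)] and
    [s = r / t < 1], the squared distances differ by [((1 - s) * t) ^+ 2 + 2 * (1 - s) * (s * t ^+ 2
    - dot (x - c) (b - c))]. The first term is positive, and the second is nonnegative by
    Cauchy-Schwarz. *)
Lemma ball_projection_lt (R : realType) (p : nat) (r : R) (c b x : 'cV[R]_p) :
  r < l2norm (b - c) -> l2norm (x - c) <= r ->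
  l2norm (x - (c + (r / l2norm (b - c)) *: (b - c))) < l2norm (x - b).
Proof.
set t := l2norm (b - c); set s := r / t => rt xr.
have r_ge0 : 0 <= r := le_trans (l2norm_ge0 _) xr.
have t_gt0 : 0 < t := le_lt_trans r_ge0 rt.
have s_lt1 : s < 1 by rewrite ltr_pdivrMr // mul1r.
have st : s * t = r by rewrite divfK // gt_eqF.
have -> : x - (c + s *: (b - c)) = 1 *: (x - c) - s *: (b - c).
  by rewrite scale1r opprD addrA.
have -> : x - b = 1 *: (x - c) - 1 *: (b - c).
  by rewrite !scale1r opprB addrA subrK.
rewrite -(ltr_pXn2r (ltn0Sn 1)) ?nnegrE ?l2norm_ge0 //.
rewrite !sqr_l2norm_lincomb -/t.
have dot_le : dot (x - c) (b - c) <= s * t * t.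
  apply: le_trans (dot_le_l2norm _ _) _.
  by rewrite st ler_wpM2r // ltW.
have gap_gt0 : 0 < ((1 - s) * t) ^+ 2.
  by rewrite exprn_gt0 // mulr_gt0 // subr_gt0.
have : 0 <= (1 - s) * (s * t * t - dot (x - c) (b - c)).
  by rewrite mulr_ge0 // subr_ge0 // ltW.
lra.
Qed.

Lemma geometric_median_in_ball (R : realType) (p m : nat)
    (beta : 'I_m -> 'cV[R]_p) (Psi : {set 'I_m}) (r : R) (c b : 'cV[R]_p) :
  (0 < #|Psi|)%N -> (forall i, i \in Psi -> l2norm (beta i - c) <= r) ->
  is_geometric_median beta Psi b -> l2norm (b - c) <= r.
Proof.
move=> /card_gt0P[i0 i0Psi] Psi_r b_min; rewrite leNgt; apply/negP => r_lt.
have := b_min (c + (r / l2norm (b - c)) *: (b - c)); apply/negP.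
(* Every term drops strictly; the sum does too because [Psi] has the element [i0]. *)
rewrite -ltNge; apply: ltr_sum => [|i iPsi].
  by apply/hasP; exists i0; rewrite ?mem_index_enum.
by apply: ball_projection_lt => //; exact: Psi_r.
Qed.

Lemma sigma_le (R : realType) (m k : nat) (d : 'cV[R]_m) (c : R) :
  (0 < k <= #|[set j | (d j 0 <= c)%R]|)%N -> sigma k d <= c.
Proof.
(* Rank [k.+1] is position [k] of the sorted list, and sorting preserves the number of entries at
   most [c]. *)
case: k => // k /= k_lt; apply: nth_count_le; first exact: sort_le_sorted.
rewrite count_sort count_map enumT; apply: leq_trans k_lt _.
rewrite cardE /enum_mem size_filter.
by apply: sub_count => j; rewrite /= inE.
Qed.

Lemma le_sigma (R : realType) (m k l : nat) (d : 'cV[R]_m) :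
  (0 < k <= l)%N -> (l <= m)%N -> sigma k d <= sigma l d.
Proof.
move=> /andP[k_gt0 kl] lm.
(* Both positions lie inside the list because [l <= m], so the default value of [nth] does not
   occur. *)
apply: (sorted_leq_nth le_trans le_refl) (sort_le_sorted _) _ _ _ _ _;
  rewrite ?inE ?size_sort ?size_image ?card_ord; lia.
Qed.

Lemma mtilde_le (m : nat) : (0 < m)%N -> (mtilde m <= m)%N.
Proof. rewrite /mtilde; lia. Qed.

Lemma card_dominating_set (R : realType) (m : nat) (d : 'cV[R]_m)
    (delta : nat -> 'I_m) :
  (0 < m)%N -> is_delta d delta -> #|dominating_set delta| = mtilde m.
Proof.
move=> m_gt0 [_ delta_inj]; rewrite card_imset ?card_ord // => k l.
have := mtilde_le m_gt0; have := ltn_ord k; have := ltn_ord l => lm km mm.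
move/(delta_inj k.+1 l.+1) => kl; apply/val_inj.
by apply/eqP; rewrite -eqSS kl //=; lia.
Qed.

Lemma dominating_set_le (R : realType) (m : nat) (d : 'cV[R]_m)
    (delta : nat -> 'I_m) (i : 'I_m) :
  (0 < m)%N -> is_delta d delta -> i \in dominating_set delta ->
  d i 0 <= sigma (mtilde m) d.
Proof.
move=> m_gt0 [delta_sigma _] /imsetP[k _ ->].
have mm := mtilde_le m_gt0; have km := ltn_ord k.
by rewrite delta_sigma; [apply: le_sigma|]; lia.
Qed.

(** Pigeonhole: [2 * mtilde m] exceeds [m]. *)
Lemma mtilde_intersect (m : nat) (G H : {set 'I_m}) :
  (mtilde m <= #|G|)%N -> (mtilde m <= #|H|)%N -> exists i, i \in G :&: H.
Proof.
move=> Gm Hm; apply/card_gt0P.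
have := cardsUI G H; have := subset_leq_card (subsetT (G :|: H)).
rewrite cardsT card_ord.
move: Gm Hm; rewrite /mtilde; lia.
Qed.

(** Markov's inequality: each index outside [G] contributes more than [a] to a total of at most
    [a * m / 2], so fewer than half of the indices lie outside. *)
Lemma markov_majority (R : realType) (m : nat) (f : 'I_m -> nat) (a : R) :
  (0 < m)%N -> 0 < a -> (\sum_(i < m) f i)%N%:R <= a / 2 * m%:R ->
  (mtilde m <= #|[set i | ((f i)%:R <= a)%R]|)%N.
Proof.
move=> m_gt0 a_gt0 f_le; set G := [set i | _].
(* The strict bound [bad_lt] requires at least one bad index. *)
have [B0|/set0Pn[i0 i0B]] := eqVneq (~: G) set0.
  by rewrite -[G]setCK B0 setC0 cardsT card_ord mtilde_le.
have bad_lt : a * #|~: G|%:R < (\sum_(i < m) f i)%N%:R.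
  rewrite natr_sum (bigID [in ~: G]) /= -[ltLHS]addr0.
  apply: ltr_leD; last exact: sumr_ge0.
  rewrite mulr_natr -sumr_const; apply: ltr_sum => [|i].
    by apply/hasP; exists i0; rewrite ?mem_index_enum.
  by rewrite !inE ltNge.
have : (#|~: G| * 2 < m)%N.
  rewrite -(ltr_nat R) natrM -(ltr_pM2l a_gt0).
  have := lt_le_trans bad_lt f_le; lra.
have := cardsC G; rewrite card_ord /mtilde; lia.
Qed.

Theorem theorem2 (R : realType) (p n m : nat)
  (hn : (1 <= n)%N) (hm : (1 <= m)%N)
  (betastar : 'cV[R]_p)
  (X : 'I_m -> 'M[R]_(p, n)) (y u eps_noise : 'I_m -> 'cV[R]_n)
  (hy : forall i : 'I_m, y i = (X i)^T *m betastar + u i + eps_noise i)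
  (A : 'M[R]_(p, n) -> 'cV[R]_n -> 'cV[R]_p)
  (gamma0 epsilon : R)
  (hgamma0 : 0 < gamma0 < 1) (hepsilon : 0 < epsilon)
  (hA : forall i : 'I_m, (l0norm (u i))%:R <= gamma0 * n%:R ->
          l2norm (A (X i) (y i) - betastar) <= epsilon)
  (hcorr : (\sum_(i < m) l0norm (u i))%N%:R <= gamma0 / 2 * m%:R * n%:R)
  (betahat : 'cV[R]_p)
  (hout : DRLR_output A X y betahat) :
  l2norm (betahat - betastar) <= 5 * epsilon.
Proof.
case: hout; set beta := fun i => A (X i) (y i).
move=> q [delta [q_pivot q_delta b_med]].
have [gamma_gt0 _] := andP hgamma0.
have [G [G_card G_good]] : exists G : {set 'I_m}, (mtilde m <= #|G|)%N /\
    forall i, i \in G -> l2norm (beta i - betastar) <= epsilon.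
  exists [set i | (l0norm (u i))%:R <= gamma0 * n%:R]; split; last first.
    by move=> i; rewrite inE; exact: hA.
  (* Here [a] is [gamma0 * n%:R], positive since [n] is. *)
  apply: markov_majority; rewrite ?mulr_gt0 ?ltr0n //; lra.
have sigma_q : sigma (mtilde m) (dist_vec beta q) <= 2 * epsilon.
  have /card_gt0P[g gG] : (0 < #|G|)%N by apply: leq_trans G_card.
  (* The pivot does at least as well as the good batch [g], from which every good estimate is within
     [2 * epsilon] by way of [betastar]. *)
  apply: le_trans (q_pivot g) _; apply: sigma_le => /=.
  apply: leq_trans G_card (subset_leq_card _); apply/subsetP => j jG.
  rewrite inE mxE; apply: le_trans (l2norm_triangle _ betastar _) _.
  have := G_good g gG; have := G_good j jG.
  rewrite (l2norm_distC (beta j)); lra.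
have Psi_card := card_dominating_set hm q_delta.
have Psi_ball i : i \in dominating_set delta ->
    l2norm (beta i - beta q) <= 2 * epsilon.
  move=> iPsi; have := dominating_set_le hm q_delta iPsi.
  by rewrite mxE l2norm_distC => /le_trans; apply.
have [g] := mtilde_intersect G_card (eq_leq (esym Psi_card)).
rewrite inE => /andP[/G_good g_le /Psi_ball]; rewrite l2norm_distC => gq_le.
have b_le : l2norm (betahat - beta q) <= 2 * epsilon.
  by apply: geometric_median_in_ball Psi_ball b_med; rewrite Psi_card.
have := l2norm_triangle betahat (beta q) betastar.
have := l2norm_triangle (beta q) (beta g) betastar.
lra.
Qed.
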